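(* Let $f:\mathbb{R}^D\to\mathbb{R}$ be continuous with effective dimension $d_e$, $d_e<D$ and $d_e\le d$, with effective subspace $\mathcal{T}$ and constant subspace $\mathcal{T}^\perp$ spanned by the columns of the orthonormal matrices $U\in\mathbb{R}^{D\times d_e}$ and $V\in\mathbb{R}^{D\times(D-d_e)}$, respectively. Assume that there is a global minimizer $\boldsymbol{x}^*$ of $f$ over $\mathcal{X}=[-1,1]^D$ whose associated set $G^*$ is non-degenerate. Let $A$ be a $D\times d$ Gaussian matrix. Then, for any $\boldsymbol{p}\in\mathcal{X}$, $$\mathbb{P}[(\mathrm{RP}\mathcal{X})\text{ is successful}]>0.$$
   Context: A function $f:\mathbb{R}^D\to\mathbb{R}$ has effective dimension $d_e$ if there is a linear subspace $\mathcal{T}$ of dimension $d_e$ such that $f(\boldsymbol{x}_\top+\boldsymbol{x}_\perp)=f(\boldsymbol{x}_\top)$ for all $\boldsymbol{x}_\top\in\mathcal{T}$ and $\boldsymbol{x}_\perp\in\mathcal{T}^\perp$, and $d_e$ is the smallest integer with this property. $\mathcal{T}$ and $\mathcal{T}^\perp$ are called the effective and constant subspaces of $f$. For $\boldsymbol{x}\in\mathbb{R}^D$, $\boldsymbol{x}_\top=UU^T\boldsymbol{x}$. A Gaussian matrix is a random matrix with independent $\mathcal{N}(0,1)$ entries. For a global minimizer $\boldsymbol{x}^*$ of $f$ over $\mathcal{X}$, let $G^*:=\{\boldsymbol{x}\in\mathcal{X}:\boldsymbol{x}\in\boldsymbol{x}^*_\top+\mathcal{T}^\perp\}$ and $\bar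 G^*:=\{\boldsymbol{g}\in\mathbb{R}^{D-d_e}:\boldsymbol{x}^*_\top+V\boldsymbol{g}\in G^*\}$. $G^*$ is non-degenerate if $\mathrm{Vol}(\bar G^* )>0$ (Lebesgue volume in $\mathbb{R}^{D-d_e}$). Let $f^*=\min_{\boldsymbol{x}\in\mathcal{X}}f(\boldsymbol{x})$. The reduced problem $(\mathrm{RP}\mathcal{X})$ is: minimize $f(A\boldsymbol{y}+\boldsymbol{p})$ over $\boldsymbol{y}\in\mathbb{R}^d$ subject to $A\boldsymbol{y}+\boldsymbol{p}\in\mathcal{X}$. It is successful if there exists $\boldsymbol{y}^*\in\mathbb{R}^d$ with $f(A\boldsymbol{y}^*+\boldsymbol{p})=f^*$ and $A\boldsymbol{y}^*+\boldsymbol{p}\in\mathcal{X}$. *)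

(* Defs.v *)
From HB Require Import structures.
From mathcomp Require Import all_boot all_order all_algebra.
From mathcomp Require Import all_classical all_reals all_analysis.
Set Implicit Arguments.
Unset Strict Implicit.
Unset Printing Implicit Defensive.
Import Order.TTheory GRing.Theory Num.Theory.
Import numFieldNormedType.Exports.
Local Open Scope classical_set_scope.
Local Open Scope ring_scope.

Definition orthc (R : realType) (D : nat) (T : {vspace 'cV[R]_D}) :
    set 'cV[R]_D :=
  [set x | forall t, t \in T -> t^T *m x = 0].

Definition colspan (R : realType) (D k : nat) (U : 'M[R]_(D, k)) :
    {vspace 'cV[R]_D} :=
  <<[seq col j U | j <- enum 'I_k]>>%VS.

Definition orthonormal_cols (R : realType) (D k : nat) (U : 'M[R]_(D, k)) :=
  U^T *m U = 1%:M.

Definition effective_subspace (R : realType) (D : nat) (f : 'cV[R]_D -> R)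
    (k : nat) (T : {vspace 'cV[R]_D}) :=
  \dim T = k /\
  forall xt xp : 'cV[R]_D, xt \in T -> orthc T xp -> f (xt + xp) = f xt.

Definition has_effective_dimension (R : realType) (D : nat)
    (f : 'cV[R]_D -> R) (de : nat) :=
  (exists T, effective_subspace f de T) /\
  (forall k, (exists T, effective_subspace f k T) -> (de <= k)%N).

Definition cube (R : realType) (D : nat) : set 'cV[R]_D :=
  [set x | forall i, -1 <= x i ord0 <= 1].
Arguments cube : clear implicits.

Definition global_minimizer (R : realType) (D : nat) (f : 'cV[R]_D -> R)
    (X : set 'cV[R]_D) (xs : 'cV[R]_D) :=
  X xs /\ forall x, X x -> f xs <= f x.

(* An infimum; it is the minimum as soon as a global minimizer exists. *)
Definition min_value (R : realType) (D : nat) (f : 'cV[R]_D -> R)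
    (X : set 'cV[R]_D) : R :=
  inf (f @` X).

Definition Gstar (R : realType) (D k : nat) (X : set 'cV[R]_D)
    (T : {vspace 'cV[R]_D}) (U : 'M[R]_(D, k)) (xs : 'cV[R]_D) :
    set 'cV[R]_D :=
  [set x | X x /\ exists2 v, orthc T v & x = U *m U^T *m xs + v].

Definition Gbar (R : realType) (D k l : nat) (X : set 'cV[R]_D)
    (T : {vspace 'cV[R]_D}) (U : 'M[R]_(D, k)) (V : 'M[R]_(D, l))
    (xs : 'cV[R]_D) : set 'cV[R]_l :=
  [set g | Gstar X T U xs (U *m U^T *m xs + V *m g)].

Definition box (R : realType) (n : nat) (a b : 'cV[R]_n) : set 'cV[R]_n :=
  [set x | forall i, a i ord0 <= x i ord0 <= b i ord0].

Definition box_volume (R : realType) (n : nat) (a b : 'cV[R]_n) : R :=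
  \prod_(i < n) Num.max 0 (b i ord0 - a i ord0).

(* n-dimensional Lebesgue (outer) measure: the infimum of the total volume over
   all countable covers by boxes. It is the Lebesgue volume on measurable sets;
   Gbar (cube R D) T U V xs is closed. Index sets I other than setT make finite
   covers available also for n = 0, where every box has volume 1. *)
Definition lebesgue_volume (R : realType) (n : nat) (S : set 'cV[R]_n) :
    \bar R :=
  ereal_inf [set s : \bar R |
    exists (I : set nat) (a b : nat -> 'cV[R]_n),
      S `<=` \bigcup_(k in I) box (a k) (b k) /\
      s = \esum_(k in I) (box_volume (a k) (b k))%:E].

Definition mutually_independent (disp : measure_display)
    (Omega : measurableType disp) (R : realType) (P : probability Omega R)
    (I : finType) (X : I -> {RV P >-> R}) :=
  forall (J : {set I}) (B : I -> set R),
    (forall i, i \in J -> measurable (B i)) ->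
    P (\bigcap_(i in [set i | i \in J]) (X i @^-1` B i)) =
    (\prod_(i in J) P (X i @^-1` B i))%E.

Definition gaussian_matrix (disp : measure_display)
    (Omega : measurableType disp) (R : realType) (P : probability Omega R)
    (D d : nat) (A : 'I_D -> 'I_d -> {RV P >-> R}) :=
  mutually_independent (fun ij : 'I_D * 'I_d => A ij.1 ij.2) /\
  forall i j (B : set R), measurable B ->
    distribution P (A i j) B = normal_prob 0 1 B.

Definition RP_successful (R : realType) (D d : nat) (f : 'cV[R]_D -> R)
    (X : set 'cV[R]_D) (A : 'M[R]_(D, d)) (p : 'cV[R]_D) :=
  exists y : 'cV[R]_d, f (A *m y + p) = min_value f X /\ X (A *m y + p).

(* Main.v *)
Require Import Defs.
From mathcomp Require Import all_boot all_order all_algebra.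
From mathcomp Require Import all_classical all_reals all_analysis.
From mathcomp Require Import ring lra.
Import Order.TTheory GRing.Theory Num.Theory.
Import numFieldNormedType.Exports.
Local Open Scope classical_set_scope.
Local Open Scope ring_scope.

Set Implicit Arguments.
Unset Strict Implicit.
Unset Printing Implicit Defensive.

(** [f x] depends only on [U^T x], so [A y + p] is optimal as soon as
    [U^T (A y + p) = U^T xs] and [A y + p] lies in the cube. If
    [U^T p = U^T xs], then [y = 0] always works. Otherwise, a bounded piece of a
    hyperplane having volume zero, nondegeneracy yields for every coordinate
    that is not constant on [xs_T + T^perp], and for each sign, a point of the
    slice off the corresponding face; the average [x0] of these points satisfies
    all these inequalities strictly. Some matrix [M0] and some [y0] satisfy
    [M0 y0 + p = x0] with [U^T M0] of full rank, so for [M] near [M0] the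
    equation [U^T (M y + p) = U^T xs] has a solution [y] near [y0], and
    [M y + p] stays in the cube: the coordinates constant on the slice are those
    of [x0], the others remain strictly inside. Thus success contains an open
    set of matrices, which a Gaussian matrix hits with positive probability.

    The success event must also be shown measurable, since [P] is unspecified
    elsewhere: restricted to [y] in a compact cube, success is a closed
    condition on [A]. *)

(** * Limits of matrix expressions, up to the adjugate needed for Cramer's formula *)

Lemma cvg_matrix (R : realType) (m n : nat) (I : Type) (F : set_system I)
    {FF : Filter F} (g : I -> 'M[R]_(m, n)) (M : 'M[R]_(m, n)) :
  (forall i j, (fun x => g x i j) @ F --> M i j) -> g @ F --> M.
Proof.
move=> gM A [P MP PA].
rewrite /fmap /=; apply: (filterS (P := fun x => forall i j, P i j (g x i j))).
  by move=> x Px; exact: PA.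
by apply: filter_forall => i; apply: filter_forall => j; apply: gM; exact: MP.
Qed.

Lemma cvg_entry (R : realType) (m n : nat) (I : Type) (F : set_system I)
    {FF : Filter F} (g : I -> 'M[R]_(m, n)) (M : 'M[R]_(m, n)) i j :
  g @ F --> M -> (fun x => g x i j) @ F --> M i j.
Proof. by move=> gM; exact: (cvg_comp _ _ gM (@coord_continuous _ _ _ i j M)). Qed.

Lemma cvg_mulmx (R : realType) (m n k : nat) (I : Type) (F : set_system I)
    {FF : Filter F} (g : I -> 'M[R]_(m, n)) (h : I -> 'M[R]_(n, k))
    (G : 'M[R]_(m, n)) (H : 'M[R]_(n, k)) :
  g @ F --> G -> h @ F --> H -> (fun x => g x *m h x) @ F --> G *m H.
Proof.
move=> gG hH; apply: cvg_matrix => i j.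
under eq_fun do rewrite mxE.
rewrite mxE; apply: cvg_big => [|l _]; first exact: add_continuous.
 apply: cvgM.
- exact: cvg_entry.
- exact: cvg_entry.
Qed.

Lemma cvg_det (R : realType) (n : nat) (I : Type) (F : set_system I)
    {FF : Filter F} (g : I -> 'M[R]_n) (G : 'M[R]_n) :
  g @ F --> G -> (fun x => \det (g x)) @ F --> \det G.
Proof.
move=> gG; rewrite /determinant; apply: cvg_big => [|s _]; first exact: add_continuous.
apply: cvgM; first exact: cvg_cst.
apply: cvg_big => [|i _]; first exact: mul_continuous.
exact: cvg_entry.
Qed.

Lemma cvg_adjugate (R : realType) (n : nat) (I : Type) (F : set_system I)
    {FF : Filter F} (g : I -> 'M[R]_n) (G : 'M[R]_n) :
  g @ F --> G -> (fun x => \adj (g x)) @ F --> \adj G.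
Proof.
move=> gG; apply: cvg_matrix => i j.
under eq_fun do rewrite mxE.
rewrite mxE /cofactor; apply: cvgM; first exact: cvg_cst.
apply: cvg_det; apply: cvg_matrix => k l.
under eq_fun do rewrite !mxE.
rewrite !mxE.
exact: cvg_entry.
Qed.

(** * Measurability of the success event *)

(** An open set of matrices is the union of the countably many entrywise balls [B t], with rational
    centre and radius [1/(n+1)], that it contains; membership in one ball is a finite conjunction of
    conditions on single entries. *)
Lemma measurable_open_matrix (R : realType) (m n : nat) (disp : measure_display)
    (Omega : measurableType disp) (X : 'I_m -> 'I_n -> Omega -> R)
    (O : set 'M[R]_(m, n)) :
  (forall i j, measurable_fun setT (X i j)) -> open O ->
  measurable [set w | O (\matrix_(i, j) X i j w)].
Proof.
move=> mX oO.
pose B (t : 'M[rat]_(m, n) * nat) : set 'M[R]_(m, n) :=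
  [set M | forall i j, ball (ratr (t.1 i j) : R) (t.2.+1%:R^-1) (M i j)].
pose E (t : 'M[rat]_(m, n) * nat) : set Omega :=
  if `[< B t `<=` O >] then [set w | B t (\matrix_(i, j) X i j w)] else set0.
have -> : [set w | O (\matrix_(i, j) X i j w)] = \bigcup_t E t.
  apply/seteqP; split => [w /= Ow|w [t _]]; last first.
    by rewrite /E; case: asboolP => // BO Bw; exact: BO.
  set M := \matrix_(i, j) X i j w in Ow.
  have /nbhs_ballP[e /= e0 eO] : nbhs M O by exact: open_nbhs_nbhs.
  (* The centre [q] will lie within [1/(N+1)] of [M], so half of [e] keeps the whole ball around [q]
     inside the ball of radius [e] around [M]. *)
  have [N Ne] : exists N : nat, N.+1%:R^-1 < e / 2.
    have e20 : 0 < e / 2 by rewrite divr_gt0.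
    have [N _ Nlt] := near_infty_natSinv_lt (PosNum e20).
    by exists N; apply: Nlt => /=.
  have Q i j : exists q : rat, ball (ratr q : R) N.+1%:R^-1 (M i j).
    have : M i j < M i j + N.+1%:R^-1 by rewrite ltrDl invr_gt0.
    move=> /rat_in_itvoo[q]; rewrite in_itv /= => /andP[q1 q2]; exists q.
    rewrite /ball /= distrC ltr_norml; apply/andP; split.
      by rewrite ltrBrDl -ltrBrDr opprK.
    by rewrite (lt_trans (y := 0)) ?invr_gt0 // subr_lt0.
  pose q := \matrix_(i, j) sval (cid (Q i j)).
  exists (q, N) => //; rewrite /E asboolT /B /=.
    by move=> i j; rewrite /q mxE; case: cid => x.
  move=> M' BM'; apply: eO; split => // i j.
  apply: (ball_splitr (z := ratr (q i j) : R)).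
    by apply: (le_ball (ltW Ne)); rewrite /q mxE; case: cid.
  by apply: (le_ball (ltW Ne)); exact: BM'.
apply: countable_bigcupT_measurable; first exact: countableP.
move=> t; rewrite /E; case: asboolP => // _.
rewrite (_ : mkset _ = \bigcap_(i in [set: 'I_m]) \bigcap_(j in [set: 'I_n])
   (X i j @^-1` ball (ratr (t.1 i j) : R) (t.2.+1%:R^-1))); last first.
  apply/seteqP; split => [w /= Bw i _ j _|w /= Bw i j].
    by have := Bw i j; rewrite mxE.
  by rewrite mxE; exact: Bw.
apply: fin_bigcap_measurable => // i _; apply: fin_bigcap_measurable => // j _.
rewrite -[_ @^-1` _]setTI; apply: mX => //.
exact: measurable_realfun.measurable_ball.
Qed.

(** This is the tube lemma: avoiding [K] is an open condition on the pair [(y, M)], and compactness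
    of [C] makes one neighbourhood of [M] serve for all [y]. The vectors [y] are rows in order to
    match [rV_compact]. *)
Lemma open_avoid_image (R : realType) (D d : nat) (K : set 'cV[R]_D)
    (C : set 'rV[R]_d) (p : 'cV[R]_D) :
  closed K -> compact C ->
  open [set M : 'M[R]_(D, d) | forall y, C y -> ~ K (M *m y^T + p)].
Proof.
move=> cK /compact_near_coveringP cC; rewrite openE => M /= MK.
have := cC _ (nbhs M) (fun M y => ~ K (M *m y^T + p)) _.
apply => y Cy.
have : (fun z : 'rV[R]_d * 'M[R]_(D, d) => z.2 *m z.1^T + p) @ (y, M) -->
    M *m y^T + p.
  apply: cvgD; last exact: cvg_cst.
  apply: cvg_mulmx; first exact: cvg_snd.
  apply: cvg_matrix => i j; under eq_fun do rewrite mxE.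
  rewrite mxE.
  apply: (@cvg_entry R 1 d _ _ _ (fun z : 'rV[R]_d * 'M[R]_(D, d) => z.1) y j i).
  exact: cvg_fst.
move=> /(_ (~` K)) H; apply: H; apply: open_nbhs_nbhs; split; first exact: closed_openC.
exact: MK.
Qed.

(** The vector [y] ranges over a non-compact space, so the set of good matrices need not be closed.
    It is the countable union over [N] of the closed sets obtained with [y] in the cube [C N]. *)
Lemma measurable_exists_affine (R : realType) (D d : nat) (disp : measure_display)
    (Omega : measurableType disp) (X : 'I_D -> 'I_d -> Omega -> R)
    (K : set 'cV[R]_D) (p : 'cV[R]_D) :
  (forall i j, measurable_fun setT (X i j)) -> closed K ->
  measurable [set w | exists y : 'cV[R]_d, K ((\matrix_(i, j) X i j w) *m y + p)].
Proof.
move=> mX cK.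
pose C (N : nat) : set 'rV[R]_d := [set y | forall i, `[- N%:R, N%:R]%classic (y ord0 i)].
pose O N := [set M : 'M[R]_(D, d) | forall y, C N y -> ~ K (M *m y^T + p)].
rewrite (_ : mkset _ = \bigcup_N ~` [set w | O N (\matrix_(i, j) X i j w)]).
  apply: bigcupT_measurable => N; apply: measurableC.
  apply: measurable_open_matrix => //; apply: open_avoid_image => //.
  by apply: (@rV_compact R d (fun=> `[- N%:R, N%:R]%classic)) => i; exact: segment_compact.
apply/seteqP; split => [w /= [y Ky]|w /= [N _]].
  pose N := \max_i Num.bound `|y i ord0|.
  exists N => //= /(_ y^T); rewrite trmxK; apply => // i.
  rewrite /= in_itv /= -ler_norml mxE; apply/ltW.
  apply: lt_le_trans (archi_boundP (normr_ge0 _)) _.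
  by rewrite ler_nat; exact: (leq_bigmax (F := fun i => Num.bound `|y i ord0|)).
by move=> /existsNP[y] /not_implyP[_] /contrapT; exists y^T.
Qed.

(** * A Gaussian matrix charges every ball *)

(** Points of the ball have absolute value at most [M], so the density there is at least its value
    [c] at [M]. *)
Lemma normal_prob_ball_gt0 (R : realType) (x e : R) :
  0 < e -> (0 < normal_prob 0 1 (ball x e))%E.
Proof.
move=> e0.
pose M := `|x| + e.
pose c : R := normal_peak 1 * expR (- M ^+ 2 / (1 ^+ 2 *+ 2)).
have c0 : 0 < c by rewrite mulr_gt0 ?expR_gt0 ?normal_peak_gt0 ?oner_eq0.
have mB : measurable (ball x e) by exact: measurable_realfun.measurable_ball.
apply: (@lt_le_trans _ _ (c%:E * lebesgue_measure (ball x e))%E).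
  rewrite ball_itv lebesgue_measure_itv /= lte_fin.
  have xx : x - e < x + e by rewrite ltrBlDr -addrA ltrDl addr_gt0.
  by rewrite xx -EFinB -EFinM lte_fin mulr_gt0 // subr_gt0.
rewrite -integral_cst // /normal_prob; apply: ge0_le_integral => //.
- by move=> y _; rewrite lee_fin ltW.
- apply/measurable_realfun.measurable_EFinP; apply: measurable_funTS; exact: measurable_normal_pdf.
move=> y; rewrite /ball /= => xy.
rewrite lee_fin normal_pdfE ?oner_eq0 // /normal_fun subr0.
rewrite ler_wpM2l ?normal_peak_ge0 // ler_expR ler_wpM2r ?invr_ge0 ?mulrn_wge0 ?sqr_ge0 //.
rewrite lerN2 -(real_normK (num_real y)) lerXn2r ?nnegrE ?addr_ge0 // ?ltW //.
have -> : y = x - (x - y) by rewrite opprB addrC subrK.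
by apply: le_lt_trans (ler_normB _ _) _; rewrite ltrD2l.
Qed.

Lemma gaussian_matrix_ball_gt0 (R : realType) (D d : nat) (disp : measure_display)
    (Omega : measurableType disp) (P : probability Omega R)
    (A : 'I_D -> 'I_d -> {RV P >-> R}) (M : 'M[R]_(D, d)) (e : R) :
  gaussian_matrix A -> 0 < e ->
  (0 < P [set w | forall i j, ball (M i j) e (A i j w)])%E.
Proof.
move=> [indep normalA] e0.
have -> : [set w | forall i j, ball (M i j) e (A i j w)] =
    \bigcap_(ij in [set ij | ij \in [set: 'I_D * 'I_d]%SET])
      (A ij.1 ij.2 @^-1` ball (M ij.1 ij.2) e).
  apply/seteqP; split => [w /= Aw [i j] _|w /= Aw i j]; first exact: Aw.
  by apply: (Aw (i, j)); rewrite /= finset.in_setT.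
rewrite indep; last by move=> ij _; exact: measurable_realfun.measurable_ball.
apply: (@big_ind _ (fun x : \bar R => 0 < x)%E) => [|x y|ij _]; [exact: lte01|exact: mule_gt0|].
have := normal_prob_ball_gt0 (M ij.1 ij.2) e0.
rewrite -(normalA ij.1 ij.2); first by [].
exact: measurable_realfun.measurable_ball.
Qed.

(** * Volume bounds from finite covers, and bounded pieces of hyperplanes *)

Lemma lebesgue_volume_le_sum (R : realType) (n : nat) (J : finType)
    (a b : J -> 'cV[R]_n) (S : set 'cV[R]_n) :
  S `<=` \bigcup_j box (a j) (b j) ->
  (lebesgue_volume S <= (\sum_j box_volume (a j) (b j))%:E)%E.
Proof.
move=> Sab.
have vol0 (u v : 'cV[R]_n) : 0 <= box_volume u v.
  by apply: prodr_ge0 => i _; rewrite le_max lexx.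
(* Enumerating [J] by [nth] takes a default element [j0]; if [J] is empty then so is [S], and the
   empty cover will do. *)
have [j0|J0] := pickP (@predT J); last first.
  apply: ge_ereal_inf; exists 0%E; last by rewrite lee_fin sumr_ge0.
  exists set0, (fun=> 0), (fun=> 0); split; last by rewrite esum_set0.
  by move=> x /Sab[j]; have := J0 j.
move=> _; pose ej k := nth j0 (enum J) k.
apply: ge_ereal_inf; exists (\sum_j box_volume (a j) (b j))%:E => //.
exists `I_(#|J|), (a \o ej), (b \o ej); split.
  move=> x /Sab[j _ xj]; exists (enum_rank j) => //=.
  by rewrite /ej /= nth_enum_rank.
rewrite esum_fset //; last by move=> i _; rewrite lee_fin.
rewrite -fsbig_ord /= sumEFin; congr (_%:E).
rewrite (reindex (@enum_val J predT)) /=; last first.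
  by apply: onW_bij; exact: enum_val_bij.
by apply: eq_bigr => i _; rewrite /ej (enum_val_nth j0).
Qed.

Lemma lebesgue_volume_hyperplane (R : realType) (n : nat) (S : set 'cV[R]_n)
    (a : 'rV[R]_n) (c M : R) :
  a != 0 -> (forall g, S g -> (a *m g) ord0 ord0 = c) ->
  (forall g, S g -> forall i, `|g i ord0| < M) ->
  (lebesgue_volume S <= 0)%E.
Proof.
case: n S a => [|n] S a a0 aS SM.
  by rewrite (thinmx0 a) eqxx in a0.
have [->|/set0P[g0 Sg0]] := eqVneq S set0.
  have := @lebesgue_volume_le_sum R n.+1 void (fun=> 0) (fun=> 0) set0.
  by rewrite big1 //; apply => x.
have M0 : 0 < M := le_lt_trans (normr_ge0 _) (SM _ Sg0 ord0).
have [j aj] : exists j, a ord0 j != 0.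
  by apply/existsP; apply: contraNT a0 => /existsPn a0; apply/eqP/rowP => j; rewrite mxE; apply/eqP/negPn.
pose L := (\sum_(k < n) `|a ord0 (lift j k)|) / `|a ord0 j|.
have L0 : 0 <= L by rewrite divr_ge0 // sumr_ge0.
(* With [a_j != 0], the [j]-th coordinate is a Lipschitz function of the others,
   so a grid of mesh [h] on these others gives [h^-n] boxes of volume
   [O(h^(n+1))]. *)
have grid N : (lebesgue_volume S <= ((2 * L * M *+ 2) * (M *+ 2) ^+ n / N.+1%:R)%:E)%E.
  pose h := M *+ 2 / N.+1%:R.
  pose lo (phi : {ffun 'I_n -> 'I_N.+1}) k := - M + (phi k)%:R * h.
  pose top phi := (c - \sum_(k < n) a ord0 (lift j k) * lo phi k) / a ord0 j.
  pose lb phi : 'cV[R]_n.+1 :=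
    \col_i (if unlift j i is Some k then lo phi k else top phi - L * h).
  pose ub phi : 'cV[R]_n.+1 :=
    \col_i (if unlift j i is Some k then lo phi k + h else top phi + L * h).
  have Nn0 : (N.+1%:R : R) != 0 by rewrite pnatr_eq0.
  have h0 : 0 < h by rewrite divr_gt0 // pmulrn_lgt0.
  have cover : S `<=` \bigcup_phi box (lb phi) (ub phi).
    move=> g Sg.
    (* The interval [[-M, M]] is cut into [N.+1] cells of width [h]; the strict bound on [g] keeps
       the cell index below [N.+1], so [inord] does not fall back to its default. *)
    have x0 k : 0 <= (g (lift j k) ord0 + M) / h < N.+1%:R.
      have := SM _ Sg (lift j k); rewrite ltr_norml => /andP[g1 g2].
      rewrite divr_ge0 ?(ltW h0) /=; [|lra|by []].
      rewrite ltr_pdivrMr // /h mulrC divfK //; lra.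
    pose phi := [ffun k => inord (Num.truncn ((g (lift j k) ord0 + M) / h)) : 'I_N.+1].
    have lo_le k : lo phi k <= g (lift j k) ord0 <= lo phi k + h.
      have /andP[x1 x2] := x0 k; have /andP[t1 t2] := truncn_itv x1.
      have phik : phi k = Num.truncn ((g (lift j k) ord0 + M) / h) :> nat.
        by rewrite ffunE inordK // -(ltr_nat R); apply: le_lt_trans x2.
      move: t1 t2; rewrite /lo -phik ler_pdivlMr // ltr_pdivrMr // -natr1 mulrDl mul1r.
      by move=> t1 t2; apply/andP; split; lra.
    exists phi => // i; rewrite !mxE; case: unliftP => [k ->|->] //.
    have gj : a ord0 j * g j ord0 + \sum_(k < n) a ord0 (lift j k) * g (lift j k) ord0 = c.
      by rewrite -(aS _ Sg) mxE (bigD1_ord j).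
    (* [top phi] is the height of the hyperplane over the lower corner of the cell. Subtracting the
       two equations leaves only the errors in the other coordinates, each at most [h]. *)
    have : `|g j ord0 - top phi| <= L * h.
      have -> : g j ord0 - top phi =
          - (\sum_(k < n) a ord0 (lift j k) * (g (lift j k) ord0 - lo phi k)) / a ord0 j.
        rewrite (eq_bigr _ (fun k _ => mulrBr _ _ _)) sumrB /top -gj.
        by field.
      rewrite mulNr normrN normrM normfV /L mulrAC ler_wpM2r ?invr_ge0 //.
      apply: le_trans (ler_norm_sum _ _ _) _; rewrite mulr_suml.
      apply: ler_sum => k _; rewrite normrM ler_wpM2l //.
      by have /andP[l1 l2] := lo_le k; rewrite ger0_norm ?subr_ge0 // lerBlDl.
    by rewrite ler_distl addrC.
  apply: le_trans (lebesgue_volume_le_sum cover) _.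
  rewrite lee_fin.
  rewrite (eq_bigr (fun=> (2 * L * h) * h ^+ n)); last first.
    move=> phi _; rewrite /box_volume (bigD1_ord j) //=.
    rewrite !mxE unlift_none.
    have -> : top phi + L * h - (top phi - L * h) = 2 * L * h by ring.
    rewrite max_r; last by apply: mulr_ge0 (ltW h0); apply: mulr_ge0.
    congr (_ * _).
    rewrite (eq_bigr (fun=> h)); first by rewrite prodr_const card_ord.
    by move=> k _; rewrite !mxE liftK addrAC subrr add0r max_r // ltW.
  rewrite sumr_const card_ffun !card_ord.
  rewrite -[leLHS]mulr_natl natrX /h.
  move: (N.+1%:R) (L) Nn0 => q l q0.
  suff -> : q ^+ n * (2 * l * (M *+ 2 / q) * (M *+ 2 / q) ^+ n) =
      2 * l * M *+ 2 * (M *+ 2) ^+ n / q by [].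
  by rewrite expr_div_n; field; rewrite q0 expf_neq0.
(* The bound [C / N.+1] drops below [e] once [N] is the integer part of [C / e]. *)
apply/lee_addgt0Pr => e e0; rewrite add0e.
set C := _ * _ in grid.
apply: le_trans (grid (Num.truncn (C / e))) _.
rewrite lee_fin ler_pdivrMr // mulrC -ler_pdivrMr //.
by rewrite ltW // truncnS_gt.
Qed.

(** * Column spans, minimizers and the effective subspace *)

Lemma colspanP (R : realType) (D k : nat) (U : 'M[R]_(D, k)) (x : 'cV[R]_D) :
  reflect (exists c, x = U *m c) (x \in colspan U).
Proof.
apply: (iffP idP) => [|[c ->]].
  rewrite /colspan span_def big_map big_enum /= => /memv_sumP[v vU ->].
  have [c vc] : exists c : 'I_k -> R, forall j, v j = c j *: col j U.
    have H j : exists a, v j = a *: col j U by exact/vlineP/vU.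
    by exists (fun j => sval (cid (H j))) => j; case: cid.
  exists (\col_j c j); apply/colP => i; rewrite summxE mxE.
  by apply: eq_bigr => j _; rewrite vc !mxE mulrC.
have -> : U *m c = \sum_j c j ord0 *: col j U.
  by apply/colP => i; rewrite summxE mxE; apply: eq_bigr => j _; rewrite !mxE mulrC.
apply: memv_suml => j _; apply/memvZ/memv_span/map_f.
by rewrite mem_enum.
Qed.

Lemma orthc_colspanP (R : realType) (D k : nat) (U : 'M[R]_(D, k)) (x : 'cV[R]_D) :
  orthc (colspan U) x <-> U^T *m x = 0.
Proof.
split=> [xU|Ux0 t /colspanP[c ->]]; last by rewrite trmx_mul -mulmxA Ux0 mulmx0.
apply/row_matrixP => j; rewrite row0 row_mul -tr_col.
apply: xU; apply/colspanP; exists (delta_mx j ord0).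
by rewrite colE.
Qed.

Lemma min_value_global_minimizer (R : realType) (D : nat) (f : 'cV[R]_D -> R)
    (X : set 'cV[R]_D) (xs : 'cV[R]_D) :
  global_minimizer f X xs -> min_value f X = f xs.
Proof.
move=> [Xxs fmin]; apply/eqP; rewrite eq_le /min_value.
have lb : lbound (f @` X) (f xs) by move=> _ [x Xx <-]; exact: fmin.
apply/andP; split; first by apply: ge_inf; [exists (f xs)|exists xs].
by apply: lb_le_inf => //; exists (f xs), xs.
Qed.

(** Orthonormality makes [z - U (U^T z)] orthogonal to the span of [U], so [f z] is the value of [f]
    at the projection [U (U^T z)]. *)
Lemma effective_subspace_eq (R : realType) (D de k : nat) (f : 'cV[R]_D -> R)
    (U : 'M[R]_(D, k)) (x y : 'cV[R]_D) :
  orthonormal_cols U -> effective_subspace f de (colspan U) ->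
  U^T *m x = U^T *m y -> f x = f y.
Proof.
move=> UU [_ fU].
have fE z : f z = f (U *m (U^T *m z)).
  rewrite -(fU (U *m (U^T *m z)) (z - U *m (U^T *m z))); first by rewrite addrC subrK.
    by apply/colspanP; exists (U^T *m z).
  by apply/orthc_colspanP; rewrite mulmxBr (mulmxA U^T U) UU mul1mx subrr.
by move=> xy; rewrite fE xy -fE.
Qed.

Lemma orthogonal_trmx (R : realType) (D k l : nat) (U : 'M[R]_(D, k))
    (V : 'M[R]_(D, l)) :
  [set x | x \in colspan V] = orthc (colspan U) -> U^T *m V = 0.
Proof.
move=> VU; apply/matrixP => i j.
have : U^T *m col j V = 0.
  apply/orthc_colspanP; rewrite -VU /=; apply/colspanP.
  by exists (delta_mx j ord0); rewrite colE.
by move=> /colP/(_ i); rewrite colE mulmxA -colE !mxE.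
Qed.

(** * A strictly feasible point of the slice, and matrices whose image reaches the slice *)

(** Along the slice, coordinate [i] is affine in [g] with linear part [row i V]. A zero row means a
    constant coordinate, which may sit on a face of the cube and cannot be moved off it. *)
Lemma slice_strict_point (R : realType) (D k l : nat) (U : 'M[R]_(D, k))
    (V : 'M[R]_(D, l)) (xs : 'cV[R]_D) :
  (0 < D)%N -> orthonormal_cols V -> U^T *m V = 0 ->
  (0 < lebesgue_volume (Gbar (cube R D) (colspan U) U V xs))%E ->
  exists g, cube R D (U *m U^T *m xs + V *m g) /\
    forall i, row i V != 0 -> `|(U *m U^T *m xs + V *m g) i ord0| < 1.
Proof.
move=> D0 VV UV vol0; set u := U *m U^T *m xs in vol0 *.
set S := Gbar _ _ _ _ _ in vol0.
have SE g : S g <-> cube R D (u + V *m g).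
  split=> [[]//|cg]; split => //; exists (V *m g) => //.
  by apply/orthc_colspanP; rewrite mulmxA UV mul0mx.
(* [V^T V = 1] recovers [g] from the point of the cube as [V^T (x - u)]. Summing over all [j] gives
   one bound for every coordinate, and the added 1 makes it strict. *)
have [M SM] : exists M, forall g, S g -> forall j, `|g j ord0| < M.
  exists (\sum_j \sum_i `|V^T j i| * (1 + `|u i ord0|) + 1) => g /SE cg j.
  have gE : g = V^T *m (u + V *m g - u).
    by rewrite addrC addKr mulmxA VV mul1mx.
  rewrite gE mxE (le_lt_trans (ler_norm_sum _ _ _)) // ltr_pwDr //.
  rewrite (bigD1 j) //= -[leLHS]addr0 lerD ?sumr_ge0 //; last first.
    by move=> *; apply: sumr_ge0 => *; rewrite mulr_ge0 ?addr_ge0.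
  apply: ler_sum => i _; rewrite normrM ler_wpM2l // mxE (le_trans (ler_normD _ _)) //.
  rewrite [(- u) i ord0]mxE normrN lerD2r.
  by have := cg i; rewrite -ler_norml.
have nonplanar i (b : R) : row i V != 0 -> exists2 g, S g & (u + V *m g) i ord0 != b.
  move=> Vi; apply: contrapT => /forall2NP H.
  have : (lebesgue_volume S <= 0)%E; last by rewrite leNgt vol0.
  apply: (@lebesgue_volume_hyperplane _ _ _ (row i V) (b - u i ord0) M) => // g Sg.
  have [|/negP] := H g; first by move=> /(_ Sg).
  by rewrite negbK => /eqP <-; rewrite -row_mul !mxE addrAC subrr add0r.
(* The boolean selects the face: [true] is -1 and [false] is 1. For a zero row any point of [S] will
   do, and [S] is nonempty because its volume is positive. *)
have pt (t : 'I_D * bool) : exists g, S g /\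
    (row t.1 V != 0 -> (u + V *m g) t.1 ord0 != (-1) ^+ t.2).
  have [Vi|Vi] := boolP (row t.1 V != 0).
    by have [g] := nonplanar t.1 ((-1) ^+ t.2) Vi; exists g.
  have [/eqP S0|/set0P[g Sg]] := boolP (S == set0); last by exists g.
  exfalso; move: vol0; rewrite S0 ltNge => /negP; apply.
  apply: ge_ereal_inf; exists 0%E => //.
  by exists set0, (fun=> 0), (fun=> 0); rewrite esum_set0; split.
have [G HG] := choice pt.
have N0 : (0 : R) < #|{: 'I_D * bool}|%:R.
  by rewrite card_prod card_ord card_bool ltr0n muln_gt0 D0.
set N : R := _%:R in N0.
exists (N^-1 *: \sum_t G t).
have avg i : (u + V *m (N^-1 *: \sum_t G t)) i ord0 = N^-1 * \sum_t (u + V *m G t) i ord0.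
  rewrite -scalemxAr mulmx_sumr [LHS]mxE.
  rewrite (eq_bigr (fun t => u i ord0 + (V *m G t) i ord0)); last by move=> t _; rewrite mxE.
  rewrite big_split /= sumr_const -[u i ord0 *+ _]mulr_natl -/N mulrDr mulrA mulVf ?gt_eqF // mul1r.
  by congr (_ + _); rewrite mxE summxE.
have avg1 (e : R) : e = N^-1 * \sum_(t : 'I_D * bool) e.
  by rewrite sumr_const -[_ *+ _]mulr_natl mulrA mulVf ?gt_eqF // mul1r.
have bnd t i : -1 <= (u + V *m G t) i ord0 <= 1 by have [/SE] := HG t.
split=> [i|i Vi].
  rewrite avg; apply/andP; split.
    rewrite [leLHS]avg1 ler_pM2l ?invr_gt0 //; apply: ler_sum => t _.
    by have /andP[] := bnd t i.
  rewrite [leRHS]avg1 ler_pM2l ?invr_gt0 //; apply: ler_sum => t _.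
  by have /andP[] := bnd t i.
(* All summands satisfy the weak inequality, so the single strict one, with index [(i, true)] or
   [(i, false)], makes the average strict. *)
rewrite avg ltr_norml; apply/andP; split.
  rewrite [ltLHS]avg1 ltr_pM2l ?invr_gt0 //.
  rewrite [ltLHS](bigD1 (i, true)) //= [ltRHS](bigD1 (i, true)) //=.
  rewrite ltr_leD //; last by apply: ler_sum => t _; have /andP[] := bnd t i.
  have /andP[b1 _] := bnd (i, true) i; rewrite lt_neqAle b1 andbT eq_sym.
  by have [_ /(_ Vi)] := HG (i, true).
rewrite [ltRHS]avg1 ltr_pM2l ?invr_gt0 //.
  rewrite [ltLHS](bigD1 (i, false)) //= [ltRHS](bigD1 (i, false)) //=.
rewrite ltr_leD //; last by apply: ler_sum => t _; have /andP[] := bnd t i.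
have /andP[_ b1] := bnd (i, false) i; rewrite lt_neqAle b1 andbT.
by have [_ /(_ Vi)] := HG (i, false).
Qed.

(** The hypothesis [U^T x != U^T p] forces [y0] to be nonzero, which allows a linear map to send it
    to [x - p] even when [x - p] leaves the span of [U]. *)
Lemma affine_image_near_slice (R : realType) (D d k : nat) (U : 'M[R]_(D, k))
    (I : pred 'I_D) (x p : 'cV[R]_D) :
  orthonormal_cols U -> (k <= d)%N -> U^T *m x != U^T *m p ->
  (forall i, I i -> `|x i ord0| < 1) ->
  exists M0 : 'M[R]_(D, d), \forall M \near M0, exists y : 'cV[R]_d,
    U^T *m (M *m y + p) = U^T *m x /\
    forall i, I i -> `|(M *m y + p) i ord0| < 1.
Proof.
move=> UU kd Uxp xI.
pose v := U^T *m (x - p).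
pose B : 'M[R]_(k, d) := pid_mx k.
have BB : B *m B^T = 1%:M.
  by rewrite tr_pid_mx mul_pid_mx minnn (minn_idPr kd) pid_mx_1.
pose y0 := B^T *m v.
have [j yj] : exists j, y0 j ord0 != 0.
  apply: contrapT => /forallNP y00.
  have y0E : y0 = 0.
    by apply/colP => j; rewrite [RHS]mxE; apply/eqP/negPn/negP; exact: y00.
  have : v = 0 by rewrite -[v]mul1mx -BB -mulmxA -/y0 y0E mulmx0.
  by move/eqP; rewrite /v mulmxBr subr_eq0; exact/negP.
pose r : 'rV[R]_d := (y0 j ord0)^-1 *: delta_mx ord0 j.
have ry0 : r *m y0 = 1%:M.
  apply/matrixP => a b; rewrite !ord1 -scalemxAl -rowE [LHS]mxE [X in _ * X]mxE mulVf //.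
  by rewrite mxE.
(* [U B] sends [y0] to [U v], the projection of [x - p]. Since [r y0 = 1], the rank-one term adds
   the remainder at [y0]; this remainder is orthogonal to [U], so [U^T M0] is still [B]. *)
pose M0 : 'M[R]_(D, d) := U *m B + (x - p - U *m v) *m r.
have M0y0 : M0 *m y0 = x - p.
  rewrite mulmxDl -(mulmxA _ r) ry0 mulmx1 /y0 -(mulmxA U) (mulmxA B) BB mul1mx.
  by rewrite addrC subrK.
have UM0 : U^T *m M0 = B.
  rewrite mulmxDr mulmxA UU mul1mx mulmxA mulmxBr (mulmxA U^T U) UU mul1mx.
  by rewrite subrr mul0mx addr0.
exists M0; move: M0 M0y0 UM0 => M0 M0y0 UM0.
(* Looking for [y] in the range of [B^T] turns [U^T M y = v] into a square system with matrix [Q M].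
   [Y M] is its solution by Cramer's formula, continuous at [M0] because [Q M0] is the identity. *)
pose Q (M : 'M[R]_(D, d)) := U^T *m M *m B^T.
pose Y (M : 'M[R]_(D, d)) : 'cV[R]_d := (\det (Q M))^-1 *: (B^T *m (\adj (Q M) *m v)).
have cQ : Q @ nbhs M0 --> Q M0.
  by apply: cvg_mulmx (cvg_cst _); apply: cvg_mulmx (cvg_cst _) _; exact: cvg_id.
have QM0 : Q M0 = 1%:M by rewrite /Q UM0.
have detQ : \det (Q M0) != 0 by rewrite QM0 det1 oner_eq0.
have YM0 : Y M0 = y0.
  have adj1 : \adj (1%:M : 'M[R]_k) = 1%:M.
    by rewrite -[LHS]mul1mx mul_mx_adj det1.
  by rewrite /Y QM0 det1 invr1 scale1r adj1 mul1mx.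
have cY : Y @ nbhs M0 --> Y M0.
  apply: cvgZ; first by apply: cvgV => //; exact: cvg_det.
  apply: cvg_mulmx; first exact: cvg_cst.
  by apply: cvg_mulmx; [exact: cvg_adjugate|exact: cvg_cst].
have cM : (fun M => M *m Y M + p) @ nbhs M0 --> x.
  have -> : x = M0 *m Y M0 + p by rewrite YM0 M0y0 subrK.
  by apply: cvgD; [apply: cvg_mulmx; [exact: cvg_id|]|exact: cvg_cst].
have nI : \forall M \near M0, forall i, I i -> `|(M *m Y M + p) i ord0| < 1.
  have nIi i : \forall M \near M0, I i -> `|(M *m Y M + p) i ord0| < 1.
    have [Ii|nIi] := boolP (I i); last by apply: filterE => M.
    have cx : (fun M => (M *m Y M + p) i ord0) @ nbhs M0 --> x i ord0.
      exact: cvg_entry.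
    have lt1 := cvgr_norm_lt _ cx _ (xI i Ii).
    near=> M => _; near: M; exact: lt1.
  exact: (@filter_forall _ _ _ _ (nbhs_filter M0) nIi).
have nD : \forall M \near M0, \det (Q M) != 0.
  have cd : (fun M => \det (Q M)) @ nbhs M0 --> \det (Q M0) by exact: cvg_det.
  exact: (cvgr_neq0 _ cd detQ).
apply: filterS2 nI nD => M HI HD; exists (Y M); split => //.
rewrite mulmxDr [in LHS]mulmxA -scalemxAr (mulmxA (U^T *m M)) -/(Q M).
rewrite (mulmxA (Q M)) mul_mx_adj mul_scalar_mx scalerA mulVf // scale1r.
by rewrite /v mulmxBr subrK.
Unshelve. all: by end_near.
Qed.

(** * Positivity of the success probability *)

Lemma closed_cube (R : realType) (D : nat) : closed (cube R D).
Proof.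
have -> : cube R D =
    \bigcap_(i in [set: 'I_D]) ((fun x : 'cV[R]_D => x i ord0) @^-1` `[-1, 1]).
  apply/seteqP; split => [x xC i _|x xC i] /=; first by rewrite in_itv /=; exact: xC.
  by have := xC i I; rewrite /= in_itv.
apply: closed_bigI => i _; apply: preimage_closed; last exact: itv_closed.
by move=> x _; exact: coord_continuous.
Qed.

Theorem theorem3p6 (R : realType) (D d de : nat) (f : 'cV[R]_D -> R)
    (T : {vspace 'cV[R]_D}) (U : 'M[R]_(D, de)) (V : 'M[R]_(D, D - de))
    (disp : measure_display) (Omega : measurableType disp)
    (P : probability Omega R) (A : 'I_D -> 'I_d -> {RV P >-> R})
    (f_continuous : continuous f)
    (f_effdim : has_effective_dimension f de)
    (de_lt_D : (de < D)%N) (de_le_d : (de <= d)%N)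
    (T_effective : effective_subspace f de T)
    (U_orthonormal : orthonormal_cols U)
    (U_span : colspan U = T)
    (V_orthonormal : orthonormal_cols V)
    (V_span : [set x | x \in colspan V] = orthc T)
    (nondegenerate : exists2 xs : 'cV[R]_D,
       global_minimizer f (cube R D) xs &
       (0 < lebesgue_volume (Gbar (cube R D) T U V xs))%E)
    (A_gaussian : gaussian_matrix A) :
  forall p : 'cV[R]_D, cube R D p ->
    (0 < P [set w | RP_successful f (cube R D) (\matrix_(i, j) A i j w) p])%E.
Proof.
move=> p pC; subst T.
have UV := orthogonal_trmx V_span.
case: nondegenerate => xs xs_min vol0.
have [xsC fmin] := xs_min.
have D0 : (0 < D)%N by apply: leq_ltn_trans de_lt_D.
have fE := effective_subspace_eq U_orthonormal T_effective.
rewrite /RP_successful (min_value_global_minimizer xs_min).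
have [Up|Up] := eqVneq (U^T *m xs) (U^T *m p).
  rewrite (_ : mkset _ = setT) ?probability_setT //.
  apply/seteqP; split => // w _; exists 0.
  by rewrite mulmx0 add0r; split => //; exact: fE.
have [g [x0C x0V]] := slice_strict_point D0 V_orthonormal UV vol0.
set x0 := _ + _ in x0C x0V.
have Ux0 : U^T *m x0 = U^T *m xs.
  by rewrite mulmxDr !mulmxA UV mul0mx addr0 U_orthonormal mul1mx.
have [M0 nM0] := affine_image_near_slice U_orthonormal de_le_d
  (etrans (congr1 (fun z => z != U^T *m p) Ux0) Up) x0V.
have slice_cube x : U^T *m x = U^T *m xs ->
    (forall i, row i V != 0 -> `|x i ord0| < 1) -> cube R D x.
  move=> Ux xV i; have [Vi|Vi] := eqVneq (row i V) 0; last first.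
    by have := xV i Vi; rewrite ltr_norml => /andP[? ?]; rewrite !ltW.
  have : orthc (colspan U) (x - x0).
    by apply/orthc_colspanP; rewrite mulmxBr Ux Ux0 subrr.
  rewrite -V_span /= => /colspanP[c xx0].
  have /rowP/(_ ord0) : row i (V *m c) = 0 by rewrite row_mul Vi mul0mx.
  rewrite [LHS]mxE [RHS]mxE -xx0 [LHS]mxE [X in _ + X]mxE => /subr0_eq ->.
  exact: x0C.
have [e /= e0 eM0] := (nbhs_ballP _ _).1 nM0.
apply: lt_le_trans (gaussian_matrix_ball_gt0 M0 A_gaussian e0) _.
apply: le_measure; rewrite ?inE.
- rewrite (_ : mkset _ = \bigcap_(i in [set: 'I_D]) \bigcap_(j in [set: 'I_d])
     (A i j @^-1` ball (M0 i j) e)); last first.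
    by apply/seteqP; split => [w Bw i _ j _|w Bw i j]; [exact: Bw|exact: (Bw i I j I)].
  apply: fin_bigcap_measurable => // i _; apply: fin_bigcap_measurable => // j _.
  rewrite -[_ @^-1` _]setTI; apply: measurable_funPT => //.
  exact: measurable_realfun.measurable_ball.
(* Success means hitting the set of minimizers in the cube, which is closed by continuity of [f]. *)
- apply: (@measurable_exists_affine R D d _ _ (fun i j => A i j)
    ((f @^-1` [set x | x = f xs]) `&` cube R D) p).
    by move=> i j; exact: measurable_funPT.
  apply: closedI; last exact: closed_cube.
  by apply: preimage_closed; [move=> x _; exact: f_continuous|exact: closed_eq].
move=> w /= Bw.
have /eM0[y [Uy yV]] : ball M0 e (\matrix_(i, j) A i j w).
  by split => // i j; rewrite mxE.
exists y; rewrite Ux0 in Uy; split; first exact: fE.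
exact: slice_cube.
Qed.
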